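(* For every closed term $M\in\Lambda_\oplus$, $\Psi(\mathcal{S}_{\mathsf{IV}}(M))=\mathcal{S}_{\mathsf{IN}}(\lceil M\rceil(\lambda x.x))$.
   Context: Terms. $\Lambda_\oplus$ is the set of terms $M ::= x \mid \lambda x.M \mid MN \mid M\oplus N$, with $x$ ranging over a denumerable set $\mathsf{X}$ of variables, modulo renaming of bound variables; a term is closed if it has no free variables; $M[x:=N]$ is capture-avoiding substitution. $\Lambda_\oplus^+$ is defined in the same way but with variables from $\mathsf{X}\cup\mathsf{C}$, where $\mathsf{C}=\{\alpha,\beta,\gamma,\epsilon,\dots\}$ is a denumerable set of continuation variables disjoint from $\mathsf{X}$; all notions below extend verbatim to $\Lambda_\oplus^+$. A value is a variable or an abstraction, ranged over by $V,W$. Distributions. A distribution is a function $\mathscr{D}$ from values to $[0,1]$ with $\sum_{V}\mathscr{D}(V)\le 1$. $\emptyset$ is the zero distribution and $\{V^1\}$ gives probability $1$ to $V$. Order, sums, scalar multiples and $\sup$ are pointwise. Call-by-value reduction. $\mapsto_{\mathsf v}$ is the least relation between terms and finite sequences of terms such that: $(\lambda x.M)V\mapsto_{\mathsf v} M[x:=V]$; $V\oplus W\mapsto_{\mathsf v} V,W$; and, if $M\mapsto_{\mathsf v} L_1,\dots,L_n$, then $MN\mapsto_{\mathsf v} L_1N,\dots,L_nN$, $VM\mapsto_{\mathsf v} VL_1,\dots,VL_n$, $M\oplus N\mapsto_{\mathsf v} L_1\oplus N,\dots,L_n\oplus N$, and $V\oplus M\mapsto_{\mathsf v} V\oplus L_1,\dots,V\oplus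 L_n$ ($V,W$ values). Call-by-name reduction. $\mapsto_{\mathsf n}$ is the least relation between terms and finite sequences of terms such that: $(\lambda x.M)N\mapsto_{\mathsf n} M[x:=N]$; $M\oplus N\mapsto_{\mathsf n} M,N$; and, if $M\mapsto_{\mathsf n} L_1,\dots,L_n$, then $MN\mapsto_{\mathsf n} L_1N,\dots,L_nN$. Small-step semantics. $M\Rightarrow_{\mathsf{IV}}\mathscr{D}$ is defined inductively by: $M\Rightarrow_{\mathsf{IV}}\emptyset$ for every $M$; $V\Rightarrow_{\mathsf{IV}}\{V^1\}$ for every value $V$; if $M\mapsto_{\mathsf v} N_1,\dots,N_n$ and $N_i\Rightarrow_{\mathsf{IV}}\mathscr{D}_i$ for all $i$, then $M\Rightarrow_{\mathsf{IV}}\sum_{i=1}^n\frac1n\mathscr{D}_i$. $\mathcal{S}_{\mathsf{IV}}(M)=\sup\{\mathscr{D}\mid M\Rightarrow_{\mathsf{IV}}\mathscr{D}\}$. The relation $\Rightarrow_{\mathsf{IN}}$ and $\mathcal{S}_{\mathsf{IN}}(M)$ are defined identically with $\mapsto_{\mathsf n}$ in place of $\mapsto_{\mathsf v}$. Translation. $\lceil\cdot\rceil:\Lambda_\oplus\to\Lambda_\oplus^+$ is defined recursively by $\lceil x\rceil=\lambda\epsilon.\epsilon x$; $\lceil\lambda x.M\rceil=\lambda\epsilon.\epsilon(\lambda x.\lceil M\rceil)$; $\lceil MN\rceil=\lambda\epsilon.\lceil M\rceil(\lambda\alpha.\lceil N\rceil(\lambda\beta.\alpha\beta\epsilon))$;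 $\lceil M\oplus N\rceil=\lambda\epsilon.\lceil M\rceil(\lambda\alpha.\lceil N\rceil(\lambda\beta.((\lambda\gamma.\gamma\alpha)\oplus(\lambda\gamma.\gamma\beta))\epsilon))$. The map $\Psi$ from values of $\Lambda_\oplus$ to values of $\Lambda_\oplus^+$ is $\Psi(x)=x$, $\Psi(\lambda x.M)=\lambda x.\lceil M\rceil$; it is extended to distributions by push-forward, $\Psi(\mathscr{D})(W)=\sum_{V:\Psi(V)=W}\mathscr{D}(V)$. *)

(* Defs.v *)
From HB Require Import structures.
From mathcomp Require Import all_boot all_order all_algebra finmap.
From mathcomp Require Import boolp classical_sets functions cardinality fsbigop.
From mathcomp Require Import constructive_ereal reals ereal esum.

Set Implicit Arguments.
Unset Strict Implicit.
Unset Printing Implicit Defensive.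

Import Order.TTheory GRing.Theory Num.Theory.
Local Open Scope classical_set_scope.
Local Open Scope ring_scope.

(* [term A] is the set of terms, up to renaming of bound variables, whose free
   variables are taken in [A].  Under a binder, [None] is the bound variable and
   [Some x] is the variable [x] of the enclosing scope. *)
Inductive term (A : Type) : Type :=
| Var of A
| Lam of term (option A)
| App of term A & term A
| Choice of term A & term A.

Inductive value (A : Type) : Type :=
| VVar of A
| VLam of term (option A).

Coercion of_value (A : Type) (V : value A) : term A :=
  match V with VVar x => Var x | VLam M => Lam M end.

HB.instance Definition _ (A : Type) := gen_eqMixin (value A).
HB.instance Definition _ (A : Type) := gen_choiceMixin (value A).

Fixpoint free_in (A : Type) (M : term A) : set A :=
  match M with
  | Var y => [set y]
  | Lam M => [set x | free_in M (Some x)]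
  | App M N => free_in M `|` free_in N
  | Choice M N => free_in M `|` free_in N
  end.

Definition closed_term (A : Type) (M : term A) : Prop := free_in M = set0.

Fixpoint rename (A B : Type) (f : A -> B) (M : term A) : term B :=
  match M with
  | Var x => Var (f x)
  | Lam M => Lam (rename (option_map f) M)
  | App M N => App (rename f M) (rename f N)
  | Choice M N => Choice (rename f M) (rename f N)
  end.

Definition shift (A : Type) (M : term A) : term (option A) := rename Some M.

Definition up_subst (A B : Type) (s : A -> term B) (o : option A) :
    term (option B) :=
  if o is Some x then shift (s x) else Var None.

Fixpoint msubst (A B : Type) (s : A -> term B) (M : term A) : term B :=
  match M with
  | Var x => s x
  | Lam M => Lam (msubst (up_subst s) M)
  | App M N => App (msubst s M) (msubst s N)
  | Choice M N => Choice (msubst s M) (msubst s N)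
  end.

(* The term $M[x:=N]$, where [M] is the body of an abstraction over $x$. *)
Definition subst (A : Type) (M : term (option A)) (N : term A) : term A :=
  msubst (fun o => if o is Some x then Var x else N) M.

Inductive red_v (A : Type) : term A -> seq (term A) -> Prop :=
| red_v_beta M (V : value A) : red_v (App (Lam M) V) [:: subst M V]
| red_v_choice (V W : value A) : red_v (Choice V W) [:: V : term A; W : term A]
| red_v_appl M N Ls : red_v M Ls -> red_v (App M N) [seq App L N | L <- Ls]
| red_v_appr (V : value A) M Ls :
    red_v M Ls -> red_v (App V M) [seq App V L | L <- Ls]
| red_v_choicel M N Ls :
    red_v M Ls -> red_v (Choice M N) [seq Choice L N | L <- Ls]
| red_v_choicer (V : value A) M Ls :
    red_v M Ls -> red_v (Choice V M) [seq Choice V L | L <- Ls].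

Inductive red_n (A : Type) : term A -> seq (term A) -> Prop :=
| red_n_beta M N : red_n (App (Lam M) N) [:: subst M N]
| red_n_choice M N : red_n (Choice M N) [:: M; N]
| red_n_appl M N Ls : red_n M Ls -> red_n (App M N) [seq App L N | L <- Ls].

Lemma of_value_inj (A : Type) : injective (@of_value A).
Proof. by case=> [x|M] [y|N] //= [->]. Qed.

Lemma red_v_value (A : Type) (V : value A) Ls : ~ red_v V Ls.
Proof. by case: V => [x|M] H; inversion H. Qed.

Lemma red_n_value (A : Type) (V : value A) Ls : ~ red_n V Ls.
Proof. by case: V => [x|M] H; inversion H. Qed.

Lemma red_v_det (A : Type) (M : term A) Ls Ls' :
  red_v M Ls -> red_v M Ls' -> Ls = Ls'.
Proof.
move=> H; elim: H Ls' => {M Ls} [M V|V W|M N Ls H IH|V M Ls H IH|M N Ls H IH|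
    V M Ls H IH] Ls' H'; inversion H'; subst; repeat match goal with
  | E : of_value _ = of_value _ |- _ => move/of_value_inj: E => E; subst
  | E : red_v (of_value _) _ |- _ => by case: (red_v_value E)
  | E : red_v (Lam ?N) _ |- _ => by case: (@red_v_value _ (VLam N) _ E)
  | E : red_v _ _ |- map _ _ = map _ _ => rewrite (IH _ E)
  end; by [].
Qed.

Lemma red_n_det (A : Type) (M : term A) Ls Ls' :
  red_n M Ls -> red_n M Ls' -> Ls = Ls'.
Proof.
move=> H; elim: H Ls' => {M Ls} [M N|M N|M N Ls H IH] Ls' H';
  inversion H'; subst; repeat match goal with
  | E : red_n (Lam ?N) _ |- _ => by case: (@red_n_value _ (VLam N) _ E)
  | E : red_n _ _ |- map _ _ = map _ _ => rewrite (IH _ E)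
  end; by [].
Qed.

Record distr (R : realType) (T : choiceType) := Distr {
  mass :> T -> R;
  mass_ge0 : forall x, 0 <= mass x;
  mass_sum : (\esum_(x in [set: T]) (mass x)%:E <= 1)%E
}.

Section DistrTheory.
Variables (R : realType) (T : choiceType).
Implicit Types (D E : distr R T).

Lemma distr_eq D E : mass D =1 mass E -> D = E.
Proof.
case: D E => [f f0 f1] [g g0 g1] /= /funext fg; subst g.
by congr Distr; exact: Prop_irrelevance.
Qed.

Lemma esum_le1P (f : T -> R) :
  (\esum_(x in [set: T]) (f x)%:E <= 1)%E <->
  (forall s : seq T, uniq s -> \sum_(x <- s) f x <= 1).
Proof.
split=> [f1 s us|H].
  rewrite -lee_fin -sumEFin; apply: le_trans f1.
  apply: esum_ge; exists [set` s]; first by split.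
  by rewrite fsbig_seq.
apply: ge_ereal_sup => /= _ [X [finX _] <-].
by rewrite fsbig_finite//= sumEFin lee_fin; apply: H.
Qed.

Lemma mass_seq D (s : seq T) : uniq s -> \sum_(x <- s) D x <= 1.
Proof. by move: s; apply/esum_le1P; exact: mass_sum. Qed.

Lemma mass_le1 D x : D x <= 1.
Proof. by have := @mass_seq D [:: x] isT; rewrite big_seq1. Qed.

Definition dzero : distr R T.
Proof.
exists (fun=> 0) => [x//|]; apply/esum_le1P => s _.
by rewrite big1 ?ler01.
Defined.

Definition ddirac (a : T) : distr R T.
Proof.
exists (fun x => (x == a)%:R) => [x|]; first exact: ler0n.
apply/esum_le1P => s us; rewrite -natr_sum -[leRHS]/(1%:R) ler_nat.
have -> : (\sum_(x <- s) (x == a) = count_mem a s)%N.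
  by rewrite -sum1_count [RHS]big_mkcond/=; apply: eq_bigr => i _; case: eqP.
by rewrite count_uniq_mem// leq_b1.
Defined.

Definition davg n (D : 'I_n -> distr R T) : distr R T.
Proof.
exists (fun x => \sum_(i < n) n%:R^-1 * D i x) => [x|].
  by apply: sumr_ge0 => i _; rewrite mulr_ge0 ?invr_ge0 ?ler0n ?mass_ge0.
apply/esum_le1P => s us; rewrite exchange_big/=.
apply: (@le_trans _ _ (\sum_(i < n) n%:R^-1)).
  apply: ler_sum => i _; rewrite -mulr_sumr -[leRHS]mulr1.
  by rewrite ler_wpM2l ?invr_ge0 ?ler0n ?mass_seq.
rewrite sumr_const card_ord -[X in X <= _]mulr_natl.
by case: n {D} => [|n]; rewrite ?mul0r ?ler01// mulfV ?pnatr_eq0.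
Defined.

Definition dle D E : Prop := forall x, D x <= E x.

Definition directed (S : set (distr R T)) : Prop :=
  S !=set0 /\ forall D E, S D -> S E -> exists2 F, S F & dle D F /\ dle E F.

Definition dsup_mass (S : set (distr R T)) (x : T) : R :=
  sup [set D x | D in S].

Lemma dsup_has_sup (S : set (distr R T)) x :
  directed S -> has_sup [set D x | D in S].
Proof.
move=> [[D SD] _]; split; first by exists (D x), D.
by exists 1 => _ [E _ <-]; exact: mass_le1.
Qed.

Lemma directed_seq (S : set (distr R T)) (s : seq T) (e : R) :
  directed S -> 0 < e ->
  exists2 F, S F & forall x, x \in s -> dsup_mass S x - e < F x.
Proof.
move=> dS e0; elim: s => [|a s [F SF HF]].
  by case: dS => [[D SD] _]; exists D.
have [_ [G SG <-] HG] := sup_adherent e0 (@dsup_has_sup S a dS).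
case: dS => _ /(_ F G SF SG) [H SH [FH GH]]; exists H => // x.
rewrite inE => /predU1P[->|/HF xs]; first exact: lt_le_trans HG (GH _).
exact: lt_le_trans xs (FH _).
Qed.

Definition dsup (S : set (distr R T)) (dS : directed S) : distr R T.
Proof.
exists (dsup_mass S) => [x|].
  have [[D SD] _] := dS; apply: le_trans (mass_ge0 D x) _.
  by apply: ub_le_sup; [case: (@dsup_has_sup S x dS)|exists D].
apply/esum_le1P => s us; apply/ler_addgt0Pl => e e0.
have k0 : 0 < (size s).+1%:R :> R by rewrite ltr0n.
have [F SF HF] := @directed_seq S s (e / (size s).+1%:R) dS (divr_gt0 e0 k0).
apply: (@le_trans _ _ (\sum_(x <- s) (e / (size s).+1%:R + F x))).
  rewrite big_seq [leRHS]big_seq; apply: ler_sum => x /HF.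
  by rewrite ltrBlDl => /ltW.
rewrite big_split/= lerD ?mass_seq// big_const_seq count_predT iter_addr_0.
rewrite -[leLHS]mulr_natr mulrAC ler_pdivrMr//.
by apply: ler_wpM2l; [exact: ltW|rewrite ler_nat].
Defined.

End DistrTheory.

Arguments dzero {R T}.

Section PushForward.
Variables (R : realType) (T U : choiceType) (f : T -> U) (D : distr R T).

Definition push_mass (y : U) : \bar R :=
  (\esum_(x in [set x | f x = y]) (D x)%:E)%E.

Lemma push_mass_sum : (\esum_(y in [set: U]) push_mass y <= 1)%E.
Proof.
rewrite /push_mass esum_esum; last by move=> *; rewrite lee_fin mass_ge0.
apply: le_trans (mass_sum D).
rewrite (reindex_esum [set: T] _ (fun x => (f x, x)))//; split => //=.
- by move=> x y _ _ [].
- by move=> [y x] /= [_ <-]; exists x.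
Qed.

Lemma push_mass_ge0 y : (0 <= push_mass y)%E.
Proof. by apply: esum_ge0 => x _; rewrite lee_fin mass_ge0. Qed.

Lemma push_mass_fin y : push_mass y \is a fin_num.
Proof.
rewrite ge0_fin_numE ?push_mass_ge0//; apply: le_lt_trans (ltry 1).
apply: le_trans (mass_sum D); rewrite /push_mass esum_mkcond; apply: le_esum.
by move=> x _; case: ifP => // _; rewrite lee_fin mass_ge0.
Qed.

(* [fine] loses nothing, by [push_mass_fin]. *)
Definition dpush : distr R U.
Proof.
exists (fun y => fine (push_mass y)) => [y|].
  by rewrite fine_ge0 ?push_mass_ge0.
under eq_esum do rewrite fineK ?push_mass_fin//.
exact: push_mass_sum.
Defined.

End PushForward.

Inductive smallstep (R : realType) (A : Type)
    (red : term A -> seq (term A) -> Prop) :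
    term A -> distr R (value A) -> Prop :=
| ss_zero M : smallstep red M dzero
| ss_value (V : value A) : smallstep red V (ddirac R V)
| ss_step M n (N : n.-tuple (term A)) (D : 'I_n -> distr R (value A)) :
    red M N -> (forall i, smallstep red (tnth N i) (D i)) ->
    smallstep red M (davg D).

Lemma smallstep_directed (R : realType) (A : Type)
    (red : term A -> seq (term A) -> Prop) (M : term A) :
  (forall (V : value A) Ls, ~ red V Ls) ->
  (forall N Ls Ls', red N Ls -> red N Ls' -> Ls = Ls') ->
  directed (smallstep red M : set (distr R (value A))).
Proof.
move=> redV redD; split; first by exists dzero; exact: ss_zero.
have dlexx (E : distr R (value A)) : dle E E by move=> x.
have dle0 (E : distr R (value A)) : dle dzero E by move=> x; exact: mass_ge0.
move=> D E HD; elim: HD E => {M D} [M|V|M n N D rN HD IH] E HE.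
- by exists E.
- exists (ddirac R V); first exact: ss_value.
  split; first exact: dlexx.
  move: HE; move EM: (of_value V) => M HE.
  case: HE EM => {M E} [M _|W /of_value_inj->|M n N D rN _ EM] //.
  by rewrite -EM in rN; case: (redV _ _ rN).
- have HavgD : smallstep red M (davg D) by exact: ss_step rN HD.
  case: HE rN HavgD => {M E} [M rN HavgD|V /redV//|M m N' E rN' HE rN HavgD].
    by exists (davg D).
  have eN := redD _ _ _ rN rN'.
  have enm : n = m by rewrite -(size_tuple N) eN size_tuple.
  subst m; have {}eN : N' = N by exact/val_inj.
  subst N'.
  have /choice[F HF] : forall i, exists F, smallstep red (tnth N i) F /\
      (dle (D i) F /\ dle (E i) F).
    by move=> i; have [F] := IH i (E i) (HE i); exists F.
  exists (davg F); first by apply: ss_step rN _ => i; case: (HF i).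
  by split=> x; apply: ler_sum => i _;
    rewrite ler_wpM2l ?invr_ge0 ?ler0n//; case: (HF i) => _ [].
Qed.

Definition S_IV (R : realType) (A : Type) (M : term A) : distr R (value A) :=
  dsup (smallstep_directed R M (@red_v_value A) (@red_v_det A)).

Definition S_IN (R : realType) (A : Type) (M : term A) : distr R (value A) :=
  dsup (smallstep_directed R M (@red_n_value A) (@red_n_det A)).

Definition ident := nat.
Definition contvar := nat.

Definition Lambda := term ident.
Definition Lambda_plus := term (ident + contvar)%type.

(* The bound continuation variables never clash with those of the source term,
   so the translation already makes sense on a single set of free variables:
   in the last two clauses, under $\lambda\epsilon.\lambda\alpha.\lambda\beta.$,
   the variables $\epsilon,\alpha,\beta$ are [Some (Some None)], [Some None],
   [None]; under the further binder $\lambda\gamma.$ they are all shifted and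
   $\gamma$ is [None]. *)
Fixpoint cps (A : Type) (M : term A) : term A :=
  match M with
  | Var x => Lam (App (Var None) (Var (Some x)))
  | Lam M => Lam (App (Var None) (shift (Lam (cps M))))
  | App M N =>
      Lam (App (shift (cps M))
        (Lam (App (shift (shift (cps N)))
          (Lam (App (App (Var (Some None)) (Var None))
                    (Var (Some (Some None))))))))
  | Choice M N =>
      Lam (App (shift (cps M))
        (Lam (App (shift (shift (cps N)))
          (Lam (App (Choice (Lam (App (Var None) (Var (Some (Some None)))))
                            (Lam (App (Var None) (Var (Some None)))))
                    (Var (Some (Some None))))))))
  end.

Definition trans (M : Lambda) : Lambda_plus := rename inl (cps M).

Definition Psi (V : value ident) : value (ident + contvar)%type :=
  match V with
  | VVar x => VVar (inl x)
  | VLam M => VLam (rename (option_map inl) (cps M))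
  end.

(* Main.v *)
Require Import Defs.
From mathcomp Require Import all_boot all_order all_algebra reals.
From mathcomp Require Import boolp classical_sets constructive_ereal esum.

(* Both semantics are deterministic up to the probabilistic branching, so each is
   the supremum of approximants indexed by a number of steps.  A step
   $M\mapsto_v L_1,\dots,L_n$ is simulated, for an arbitrary continuation $K$, by
   exactly six call-by-name steps: with $k+6$ steps, $\lceil M\rceil K$ has the
   average of what the $\lceil L_i\rceil K$ have with $k$ steps.  The count does
   not depend on where the redex is, because descending into a subterm costs the
   same number of administrative steps before and after the contraction.  Hence
   $\Psi$ carries the $n$-th approximant of $M$ exactly to the $6n$-th approximant
   of $\lceil M\rceil(\lambda x.x)$, and, $\Psi$ being injective, the push-forward
   commutes with the suprema. *)

Set Implicit Arguments.
Unset Strict Implicit.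
Unset Printing Implicit Defensive.

Import Order.TTheory GRing.Theory Num.Theory.
Local Open Scope classical_set_scope.
Local Open Scope ring_scope.

(** * Calculus of renamings and substitutions *)

Lemma rename_comp A B C (f : A -> B) (g : B -> C) (M : term A) :
  rename g (rename f M) = rename (g \o f) M.
Proof.
elim: A / M B C f g => [A x|A M IH|A M IHM N IHN|A M IHM N IHN] B C f g //=.
- by rewrite IH; congr (Lam (rename _ M)); apply/funext; case.
- by rewrite IHM IHN.
- by rewrite IHM IHN.
Qed.

Lemma rename_shift A B (f : A -> B) (M : term A) :
  rename (option_map f) (shift M) = shift (rename f M).
Proof. by rewrite /shift !rename_comp. Qed.

Lemma option_map_inj A B (f : A -> B) : injective f -> injective (option_map f).
Proof. by move=> finj [x|] [y|] //= [/finj->]. Qed.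

Lemma rename_inj A B (f : A -> B) : injective f -> injective (rename f).
Proof.
move=> + M; elim: A / M B f => [A x|A M IH|A M IHM N IHN|A M IHM N IHN] B f finj
  [y|P|P Q|P Q] //= [].
- by move/finj->.
- by move/(IH _ _ (option_map_inj finj))->.
- by move=> /(IHM _ _ finj)-> /(IHN _ _ finj)->.
- by move=> /(IHM _ _ finj)-> /(IHN _ _ finj)->.
Qed.

Lemma msubst_rename A B C (f : A -> B) (s : B -> term C) (M : term A) :
  msubst s (rename f M) = msubst (s \o f) M.
Proof.
elim: A / M B C f s => [A x|A M IH|A M IHM N IHN|A M IHM N IHN] B C f s //=.
- by rewrite IH; congr (Lam (msubst _ M)); apply/funext; case.
- by rewrite IHM IHN.
- by rewrite IHM IHN.
Qed.

Lemma rename_msubst A B C (s : A -> term B) (g : B -> C) (M : term A) :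
  rename g (msubst s M) = msubst (rename g \o s) M.
Proof.
elim: A / M B C s g => [A x|A M IH|A M IHM N IHN|A M IHM N IHN] B C s g //=.
- rewrite IH; congr (Lam (msubst _ M)); apply/funext => -[x|] //=.
  exact: rename_shift.
- by rewrite IHM IHN.
- by rewrite IHM IHN.
Qed.

Lemma msubst_Var A (M : term A) : msubst (@Var A) M = M.
Proof.
elim: A / M => [A x|A M IH|A M IHM N IHN|A M IHM N IHN] //=.
- by rewrite -[in RHS]IH; congr (Lam (msubst _ M)); apply/funext; case.
- by rewrite IHM IHN.
- by rewrite IHM IHN.
Qed.

Lemma msubst_shift A B (s : A -> term B) (M : term A) :
  msubst (up_subst s) (shift M) = shift (msubst s M).
Proof. by rewrite /shift msubst_rename rename_msubst. Qed.

(** The substitution inside [subst], named so that it can be folded and lifted by [up_subst]. *)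
Definition inst A (N : term A) (o : option A) : term A :=
  if o is Some x then Var x else N.

Lemma inst_shift A (N M : term A) : msubst (inst N) (shift M) = M.
Proof. by rewrite /shift msubst_rename -[RHS]msubst_Var. Qed.

Lemma rename_subst A B (f : A -> B) (M : term (option A)) (N : term A) :
  rename f (subst M N) = subst (rename (option_map f) M) (rename f N).
Proof.
rewrite /subst rename_msubst msubst_rename.
by congr msubst; apply/funext; case.
Qed.

(** * The translation against renaming and substitution *)

Definition rename_value A B (f : A -> B) (V : value A) : value B :=
  match V with
  | VVar x => VVar (f x)
  | VLam M => VLam (rename (option_map f) M)
  end.

(** This is [Psi] over a single set of variables; [PsiE] adds the injection [inl]. *)
Definition cps_value A (V : value A) : value A :=
  match V with VVar x => VVar x | VLam M => VLam (cps M) end.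

Lemma of_value_rename A B (f : A -> B) (V : value A) :
  rename_value f V = rename f V :> term B.
Proof. by case: V. Qed.

Lemma cps_of_value A (V : value A) :
  cps V = Lam (App (Var None) (shift (cps_value V))).
Proof. by case: V. Qed.

Lemma cps_rename A B (f : A -> B) (M : term A) :
  cps (rename f M) = rename f (cps M).
Proof.
elim: A / M B f => [A x|A M IH|A M IHM N IHN|A M IHM N IHN] B f //=.
- by rewrite !IH -(rename_shift f (Lam (cps M))).
- by rewrite IHM IHN !rename_shift.
- by rewrite IHM IHN !rename_shift.
Qed.

Lemma cps_value_rename A B (f : A -> B) (V : value A) :
  cps_value (rename_value f V) = rename_value f (cps_value V).
Proof. by case: V => [x|M] //=; rewrite cps_rename. Qed.

(** Restricting [s] to values makes the variable case hold: putting [cps_value V] for [x] in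
    [cps (Var x)] gives exactly [cps V]. *)
Lemma cps_msubst A B (s : A -> value B) (M : term A) :
  cps (msubst (fun x => s x) M) = msubst (fun x => cps_value (s x)) (cps M).
Proof.
elim: A / M B s => [A x|A M IH|A M IHM N IHN|A M IHM N IHN] B s.
- by rewrite /= cps_of_value.
(* The lift of [s] under the binder is again value-valued, so the induction hypothesis applies to
   it. *)
- pose s' o := if o is Some x then rename_value Some (s x) else VVar None.
  have /= -> := msubst_shift (fun x => cps_value (s x)) (Lam (cps M)).
  have -> : up_subst (fun x => s x) = fun o => s' o :> term _.
    by apply/funext => -[x|] //=; rewrite of_value_rename.
  have -> : up_subst (fun x => cps_value (s x))
      = fun o => cps_value (s' o) :> term _.
    by apply/funext => -[x|] //=; rewrite cps_value_rename of_value_rename.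
  by rewrite -IH.
- by rewrite /= !msubst_shift IHM IHN.
- by rewrite /= !msubst_shift IHM IHN.
Qed.

Lemma cps_subst A (M : term (option A)) (V : value A) :
  cps (subst M V) = subst (cps M) (cps_value V).
Proof.
pose s o := if o is Some x then VVar x else V.
have e : inst V = fun o => s o :> term A by apply/funext; case.
rewrite /subst -/(inst V) e cps_msubst; congr msubst.
by apply/funext; case.
Qed.

Lemma cps_inj A : injective (@cps A).
Proof.
have SomeI B : injective (@Some B) by move=> x y [].
have shiftI B : injective (@shift B) := rename_inj (SomeI B).
move=> M; elim: A / M => [A x|A M IH|A M IHM N IHN|A M IHM N IHN]
  [y|P|P Q|P Q] //=.
- by case=> ->.
- by case=> /(rename_inj (option_map_inj (SomeI _)))/IH->.
(* The heads clash: a variable on one side, on the other a shifted translation, which is an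
   abstraction whatever [P] is. *)
- by case: P.
- by case: P.
- by case: (M).
- by case=> /(shiftI _ _ _)/IHM-> /(shiftI _ _ _)/(shiftI _ _ _)/IHN->.
- by case: (M).
- by case=> /(shiftI _ _ _)/IHM-> /(shiftI _ _ _)/(shiftI _ _ _)/IHN->.
Qed.

Lemma PsiE V : Psi V = cps_value (rename_value inl V).
Proof. by case: V => [x|M] //=; rewrite cps_rename. Qed.

Lemma Psi_inj : injective Psi.
Proof.
move=> [x|M] [y|N] //= [].
  by move=> ->.
by move=> /rename_inj/cps_inj-> // [x|] [y|] //= [->].
Qed.

(** Source terms live over [ident], their translations over a larger set; moving source steps along
    [inl] lets the simulation work over one variable set. *)
Lemma red_v_rename A B (f : A -> B) (M : term A) Ls :
  red_v M Ls -> red_v (rename f M) (map (rename f) Ls).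
Proof.
elim=> {M Ls} [M V|V W|M N Ls _ IH|V M Ls _ IH|M N Ls _ IH|V M Ls _ IH] /=.
- by rewrite rename_subst -!of_value_rename; exact: red_v_beta.
- by rewrite -!of_value_rename; exact: red_v_choice.
- by rewrite -map_comp (map_comp (fun L => App L (rename f N))); exact: red_v_appl.
- rewrite -map_comp -!of_value_rename.
  rewrite (eq_map (g := (fun L => App (rename_value f V) L) \o rename f)).
    by rewrite map_comp; exact: red_v_appr.
  by move=> L; rewrite /= of_value_rename.
- by rewrite -map_comp (map_comp (fun L => Defs.Choice L (rename f N)));
    exact: red_v_choicel.
- rewrite -map_comp -!of_value_rename.
  rewrite (eq_map (g := (fun L => Defs.Choice (rename_value f V) L) \o rename f)).
    by rewrite map_comp; exact: red_v_choicer.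
  by move=> L; rewrite /= of_value_rename.
Qed.

(** * Administrative call-by-name steps of translated terms *)

Section CPSReduction.
Variable A : Type.
Implicit Types (M N K T U : term A) (V : value A).

Lemma red_n_beta_eq Q N P : subst Q N = P -> red_n (App (@Lam A Q) N) [:: P].
Proof. by move=> <-; exact: red_n_beta. Qed.

(* The translations of applications and choices differ only in the body [Q];
   [bin_k1], [bin_k2] and [bin_end] are what is left once the continuation [K],
   then the value [T] of the left subterm, then the value [U] of the right one
   have been substituted. *)
Definition cps_bin M N (Q : term (option (option (option A)))) : term A :=
  Lam (App (shift (cps M)) (Lam (App (shift (shift (cps N))) (Lam Q)))).

Definition bin_k1 N Q K : term A :=
  Lam (App (shift (cps N)) (Lam (msubst (up_subst (up_subst (inst K))) Q))).

Definition bin_k2 Q K T : term A :=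
  Lam (msubst (up_subst (inst T)) (msubst (up_subst (up_subst (inst K))) Q)).

Definition bin_end Q K T U : term A :=
  subst (msubst (up_subst (inst T)) (msubst (up_subst (up_subst (inst K))) Q)) U.

Lemma red_cps_value V K : red_n (App (cps V) K) [:: App K (cps_value V)].
Proof.
rewrite cps_of_value; apply: red_n_beta_eq.
by rewrite /subst -/(inst K) /= inst_shift.
Qed.

Lemma red_cps_bin M N Q K :
  red_n (App (cps_bin M N Q) K) [:: App (cps M) (bin_k1 N Q K)].
Proof.
apply: red_n_beta_eq.
by rewrite /subst -/(inst K) /= msubst_shift !inst_shift.
Qed.

Lemma red_bin_k1 N Q K T :
  red_n (App (bin_k1 N Q K) T) [:: App (cps N) (bin_k2 Q K T)].
Proof.
by apply: red_n_beta_eq; rewrite /subst -/(inst T) /= inst_shift.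
Qed.

Lemma red_bin_k2 Q K T U : red_n (App (bin_k2 Q K T) U) [:: bin_end Q K T U].
Proof. exact: red_n_beta. Qed.

Definition app_body : term (option (option (option A))) :=
  App (App (Var (Some None)) (Var None)) (Var (Some (Some None))).

Definition choice_body : term (option (option (option A))) :=
  App (Defs.Choice (Lam (App (Var None) (Var (Some (Some None)))))
                   (Lam (App (Var None) (Var (Some None)))))
      (Var (Some (Some None))).

Lemma cps_App M N : cps (App M N) = cps_bin M N app_body.
Proof. by []. Qed.

Lemma cps_Choice M N : cps (Defs.Choice M N) = cps_bin M N choice_body.
Proof. by []. Qed.

Lemma bin_end_app K T U : bin_end app_body K T U = App (App T U) K.
Proof.
by rewrite /bin_end /subst -/(inst U) /= !(msubst_shift, inst_shift).
Qed.

(** Substitution turns each branch $\lambda\gamma.\gamma\alpha$ into the translation of the value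
    put for $\alpha$, so that choosing yields [cps V] or [cps W] applied to [K]. *)
Lemma bin_end_choice K V W : bin_end choice_body K (cps_value V) (cps_value W) =
  App (Defs.Choice (cps V) (cps W)) K.
Proof.
rewrite !cps_of_value /bin_end /subst -/(inst _) /=.
by rewrite !(msubst_shift, inst_shift).
Qed.

End CPSReduction.

(** * The semantics as a supremum of step-indexed approximants *)

Section Approximants.
Variables (R : realType) (A : Type) (red : term A -> seq (term A) -> Prop).
Hypothesis redV : forall (V : value A) Ls, ~ red V Ls.
Hypothesis redD : forall M Ls Ls', red M Ls -> red M Ls' -> Ls = Ls'.

Definition value_of (M : term A) : option (value A) :=
  match M with
  | Var x => Some (VVar x)
  | Lam M => Some (VLam M)
  | _ => None
  end.

Lemma value_ofK (V : value A) : value_of V = Some V.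
Proof. by case: V. Qed.

Lemma value_of_Some (M : term A) V : value_of M = Some V -> M = V.
Proof. by case: M => //= [x|M] [<-]. Qed.

Definition reducts (M : term A) : seq (term A) :=
  if pselect (exists Ls, red M Ls) is left e then sval (cid e) else [::].

Lemma reductsE M Ls : red M Ls -> reducts M = Ls.
Proof.
move=> rM; rewrite /reducts; case: pselect => [e|[]]; last by exists Ls.
by case: (cid e) => Ls' /= /redD; apply.
Qed.

(* The best approximant derivable with at most [n] steps.  A stuck term has no
   reducts, and the average over zero distributions is zero. *)
Fixpoint approx (n : nat) (M : term A) : distr R (value A) :=
  if n is m.+1 then
    if value_of M is Some V then ddirac R V
    else davg (fun i => approx m (tnth (in_tuple (reducts M)) i))
  else dzero.

Lemma approx_red M Ls n V : red M Ls ->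
  approx n.+1 M V = (size Ls)%:R^-1 * \sum_(L <- Ls) approx n L V.
Proof.
move=> rM /=; case E: (value_of M) => [W|].
  by rewrite (value_of_Some E) in rM; case: (redV rM).
rewrite /= (reductsE rM) -mulr_sumr; congr (_ * _).
by rewrite [RHS]big_tnth.
Qed.

Lemma approx_red1 M N n : red M [:: N] -> approx n.+1 M = approx n N.
Proof.
by move=> rM; apply: distr_eq => V; rewrite (approx_red _ _ rM) big_seq1 invr1 mul1r.
Qed.

Lemma approx_value n (V : value A) : approx n.+1 V = ddirac R V.
Proof. by rewrite /= value_ofK. Qed.

Lemma approx_stuck n M :
  value_of M = None -> (forall Ls, ~ red M Ls) -> approx n M = dzero.
Proof.
case: n => [//|n] /= -> sM; have rM0 : reducts M = [::].
  by rewrite /reducts; case: pselect => // e; case: (cid e) => Ls /= /sM.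
by apply: distr_eq => V /=; rewrite rM0 big_ord0.
Qed.

Lemma approx_mono M : {homo (fun n => approx n M) : m n / (m <= n)%N >-> dle m n}.
Proof.
apply: homo_leq => [D V|D E F DE EF V|n]; first by [].
  exact: le_trans (DE V) (EF V).
elim: n M => [M V|n IH M V]; first exact: mass_ge0.
rewrite /=; case: (value_of M) => //=.
by apply: ler_sum => i _; rewrite ler_wpM2l ?invr_ge0 ?ler0n//; exact: IH.
Qed.

Lemma smallstep_approx n M : smallstep red M (approx n M).
Proof.
elim: n M => [|n IH] M; first exact: ss_zero.
case E: (value_of M) => [V|].
  by rewrite (value_of_Some E) approx_value; exact: ss_value.
case: (pselect (exists Ls, red M Ls)) => [[Ls rM]|sM].
  rewrite /= E; apply: (@ss_step _ _ _ _ _ (in_tuple (reducts M))) => [|i].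
    by rewrite /= (reductsE rM).
  exact: IH.
rewrite approx_stuck//; first exact: ss_zero.
by move=> Ls rM; apply: sM; exists Ls.
Qed.

Lemma smallstep_le_approx M D :
  smallstep red M D -> exists n, dle D (approx n M).
Proof.
elim=> {M D} [M|V|M n N D rM _ IH]; first by exists 0.
  by exists 1; rewrite approx_value.
(* The branches may need different numbers of steps; monotonicity raises them all to the maximum,
   and one more step pays for the reduction of [M]. *)
have /choice[k Hk] := IH; exists (\max_i k i).+1 => V.
rewrite (approx_red _ _ rM) size_tuple /= -mulr_sumr.
rewrite ler_wpM2l ?invr_ge0 ?ler0n// big_tuple.
apply: ler_sum => i _; apply: le_trans (Hk i V) _.
by apply: approx_mono; exact: leq_bigmax.
Qed.

(** Multiples of [k] are cofinal among step counts and approximants increase. The factor is 1 for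
    the source and 6 for the target. *)
Lemma dsup_approx k M (d : directed (smallstep red M : set (distr R _))) V :
  (0 < k)%N -> dsup d V = sup (range (fun n => approx (k * n) M V)).
Proof.
move=> k0; apply/eqP; rewrite eq_le; apply/andP; split.
  apply: ge_sup => [|_ [D rD <-]]; first by case: (dsup_has_sup V d).
  have [n Dn] := smallstep_le_approx rD.
  apply: (@le_trans _ _ (approx (k * n) M V)).
    by apply: le_trans (Dn V) _; apply: approx_mono; exact: leq_pmull.
  apply: ub_le_sup; last by exists n.
  by exists 1 => _ [m _ <-]; exact: mass_le1.
apply: ge_sup => [|_ [n _ <-]]; first by exists (approx (k * 0) M V), 0.
apply: ub_le_sup; first by case: (dsup_has_sup V d).
by exists (approx (k * n) M) => //; exact: smallstep_approx.
Qed.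

End Approximants.

(** * Push-forward on and off the image *)

Lemma dpush_img (R : realType) (T U : choiceType) (f : T -> U)
    (D : distr R T) x : injective f -> dpush f D (f x) = D x.
Proof.
move=> finj; rewrite /= /push_mass.
have -> : [set z | f z = f x] = [set x].
  by apply/seteqP; split=> z /= => [/finj|->].
by rewrite esum_set1// lee_fin mass_ge0.
Qed.

Lemma dpush_nimg (R : realType) (T U : choiceType) (f : T -> U)
    (D : distr R T) y : (forall x, f x <> y) -> dpush f D y = 0.
Proof.
move=> fy; rewrite /= /push_mass.
have -> : [set z | f z = y] = set0 by apply/seteqP; split=> z //= /fy.
by rewrite esum_set0.
Qed.

(** * Six-step simulation, and stuck terms *)

Section Simulation.
Variables (R : realType) (A : Type).
Implicit Types (M N K T : term A) (V W : value A).

Local Notation approx_v := (approx R (@red_v A)).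
Local Notation approx_n := (approx R (@red_n A)).
Local Notation approx_n_red1 :=
  (approx_red1 R (@red_n_value A) (@red_n_det A)).

(** At [n = 0] the equation says that [T] yields nothing within six steps, which [six_steps_expand]
    exploits. *)
Definition six_steps T (Ts : seq (term A)) := forall n V,
  approx_n (6 + n) T V = (size Ts)%:R^-1 * \sum_(L <- Ts) approx_n n L V.

(** A common administrative step costs one unit before the contraction and one after it, in every
    branch, so the delay stays six. *)
Lemma six_steps_expand (F G : term A -> term A) T (Ts : seq (term A)) :
  (forall L, red_n (G L) [:: F L]) ->
  six_steps (F T) (map F Ts) -> six_steps (G T) (map G Ts).
Proof.
move=> GF FT n V; rewrite size_map big_map.
case: n => [|n].
  (* With no step left the branches [G L] give zero. Six steps of [G T] are five of [F T], hence at
     most six of [F T], which also give zero. *)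
  rewrite (approx_n_red1 _ (GF T)) big1 ?mulr0 //.
  apply/eqP; rewrite eq_le mass_ge0 andbT.
  apply: (@le_trans _ _ (approx_n 6 (F T) V)).
    by apply: approx_mono.
  by rewrite (FT 0%N V) big1 ?mulr0.
rewrite addnS (approx_n_red1 _ (GF T)) FT size_map big_map.
by under [in RHS]eq_bigr do rewrite (approx_n_red1 _ (GF _)).
Qed.

Lemma approx_cps_bin n M N Q K :
  approx_n n.+1 (App (cps_bin M N Q) K) =
  approx_n n (App (cps M) (bin_k1 N Q K)).
Proof. exact/approx_n_red1/red_cps_bin. Qed.

Lemma approx_bin_k1 n V N Q K :
  approx_n n.+2 (App (cps V) (bin_k1 N Q K)) =
  approx_n n (App (cps N) (bin_k2 Q K (cps_value V))).
Proof.
rewrite (approx_n_red1 _ (red_cps_value _ _)).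
exact/approx_n_red1/red_bin_k1.
Qed.

Lemma approx_bin_k2 n V Q K T :
  approx_n n.+2 (App (cps V) (bin_k2 Q K T)) =
  approx_n n (bin_end Q K T (cps_value V)).
Proof.
rewrite (approx_n_red1 _ (red_cps_value _ _)).
exact/approx_n_red1/red_bin_k2.
Qed.

Lemma six_steps_binl M N Q K Ls :
  six_steps (App (cps M) (bin_k1 N Q K))
    [seq App (cps L) (bin_k1 N Q K) | L <- Ls] ->
  six_steps (App (cps_bin M N Q) K) [seq App (cps_bin L N Q) K | L <- Ls].
Proof.
by apply: (six_steps_expand (F := fun L => App (cps L) _)
  (G := fun L => App (cps_bin L N Q) K)) => L; exact: red_cps_bin.
Qed.

(** Three administrative steps lead to the right subterm: entering the term, passing the left value
    to its continuation, and contracting that continuation. Each is peeled off in turn. *)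
Lemma six_steps_binr V M Q K Ls :
  six_steps (App (cps M) (bin_k2 Q K (cps_value V)))
    [seq App (cps L) (bin_k2 Q K (cps_value V)) | L <- Ls] ->
  six_steps (App (cps_bin V M Q) K) [seq App (cps_bin V L Q) K | L <- Ls].
Proof.
move=> H.
apply: (six_steps_expand (F := fun L => App (cps V) (bin_k1 L Q K))
  (G := fun L => App (cps_bin V L Q) K)) => [L|]; first exact: red_cps_bin.
apply: (six_steps_expand (F := fun L => App (bin_k1 L Q K) (cps_value V))
  (G := fun L => App (cps V) (bin_k1 L Q K))) => [L|].
  exact: red_cps_value.
by apply: (six_steps_expand (F := fun L => App (cps L) _)
  (G := fun L => App (bin_k1 L Q K) (cps_value V)) _ H) => L; exact: red_bin_k1.
Qed.

(** At a redex, one step enters the term, two process each value, and the sixth is the contraction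
    or the choice itself. [K] stays general because descending into a subterm changes the
    continuation. *)
Lemma red_v_six_steps M Ls K :
  red_v M Ls -> six_steps (App (cps M) K) [seq App (cps L) K | L <- Ls].
Proof.
move=> rM; elim: rM K => {M Ls} [M V|V W|M N Ls _ IH|V M Ls _ IH|M N Ls _ IH|
    V M Ls _ IH] K.
- move=> n U; rewrite big_seq1 invr1 mul1r -/(of_value (VLam M)) cps_App.
  rewrite !addSn add0n approx_cps_bin approx_bin_k1 approx_bin_k2 bin_end_app.
  by rewrite cps_subst (approx_n_red1 _ (red_n_appl _ (red_n_beta _ _))).
- move=> n U; rewrite cps_Choice !addSn add0n.
  rewrite approx_cps_bin approx_bin_k1 approx_bin_k2 bin_end_choice.
  by rewrite (approx_red _ (@red_n_value A) (@red_n_det A) _ _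
    (red_n_appl K (red_n_choice _ _))).
- by rewrite -map_comp; exact: six_steps_binl.
- by rewrite -map_comp; exact: six_steps_binr.
- by rewrite -map_comp; exact: six_steps_binl.
- by rewrite -map_comp; exact: six_steps_binr.
Qed.

Lemma approx_cps_bin_stuck M N Q K n :
  (forall K m, approx_n m (App (cps M) K) = dzero) ->
  approx_n n (App (cps_bin M N Q) K) = dzero.
Proof. by move=> M0; case: n => // n; rewrite approx_cps_bin. Qed.

Lemma approx_cps_binr_stuck V N Q K n :
  (forall K m, approx_n m (App (cps N) K) = dzero) ->
  approx_n n (App (cps_bin V N Q) K) = dzero.
Proof.
move=> N0; case: n => [|[|[|n]]] //.
- by rewrite approx_cps_bin.
- by rewrite approx_cps_bin (approx_n_red1 _ (red_cps_value _ _)).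
- by rewrite approx_cps_bin approx_bin_k1.
Qed.

(** A stuck term has a variable applied to a value in evaluation position, and its translation gets
    stuck on that same variable. Carrying [f] keeps the stuckness hypothesis on the source, so no
    step of [rename f M] has to be pulled back. *)
Lemma stuck_cps B (f : B -> A) (M : term B) :
  value_of M = None -> (forall Ls, ~ red_v M Ls) ->
  forall K n, approx_n n (App (cps (rename f M)) K) = dzero.
Proof.
elim: B / M f => [//|//|B M IHM N IHN|B M IHM N IHN] f _ sMN K n.
- rewrite [rename _ _]/= cps_App; case EM: (value_of M) => [V|]; last first.
    apply: approx_cps_bin_stuck; apply: IHM => // Ls rM.
    exact: sMN (red_v_appl N rM).
  rewrite (value_of_Some EM) -of_value_rename in sMN *.
  case EN: (value_of N) => [W|]; last first.
    apply: approx_cps_binr_stuck; apply: IHN => // Ls rN.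
    exact: sMN (red_v_appr V rN).
  rewrite (value_of_Some EN) -of_value_rename in sMN *.
  case: V sMN {EM} => [x sMN|P /(_ _ (red_v_beta P W))//].
  (* Fewer than five steps end inside the administrative prefix; after five, the term is the
     variable [f x] applied to a value and to [K]. *)
  case: n => // n; rewrite approx_cps_bin.
  case: n => [//|[|n]]; first by rewrite (approx_n_red1 _ (red_cps_value _ _)).
  rewrite approx_bin_k1; case: n => [//|[|n]].
    by rewrite (approx_n_red1 _ (red_cps_value _ _)).
  rewrite approx_bin_k2 bin_end_app; apply: approx_stuck => // Ls r.
  by inversion r as [| |? ? ? r']; inversion r' as [| |? ? ? r'']; inversion r''.
- rewrite [rename _ _]/= cps_Choice; case EM: (value_of M) => [V|]; last first.
    apply: approx_cps_bin_stuck; apply: IHM => // Ls rM.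
    exact: sMN (red_v_choicel N rM).
  rewrite (value_of_Some EM) -of_value_rename in sMN *.
  case EN: (value_of N) => [W|]; last first.
    apply: approx_cps_binr_stuck; apply: IHN => // Ls rN.
    exact: sMN (red_v_choicer V rN).
  by rewrite (value_of_Some EN) in sMN; case: (sMN _ (red_v_choice V W)).
Qed.

End Simulation.

(** * Comparison of the two semantics *)

Lemma dpush_approx (R : realType) (M : Lambda) n :
  dpush Psi (approx R (@red_v _) n M) =
  approx R (@red_n _) (6 * n) (App (trans M) (Lam (Var None))).
Proof.
rewrite /trans -cps_rename; apply: distr_eq.
elim: n M => [M W|n IH M W].
  by rewrite muln0 /= /push_mass esum1.
rewrite mulnS; case E: (value_of M) => [V|].
  rewrite (value_of_Some E) approx_value -of_value_rename.
  rewrite !addSn add0n.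
  (* Two steps hand the value to the identity and return it; the four remaining ones leave the
     approximant of a value unchanged. *)
  rewrite (approx_red1 R (@red_n_value _) (@red_n_det _) _ (red_cps_value _ _)).
  rewrite (approx_red1 R (@red_n_value _) (@red_n_det _) _ (red_n_beta _ _)).
  rewrite [subst _ _]/= -PsiE approx_value.
  case: (pselect (exists V', Psi V' = W)) => [[V' <-]|nW].
    by rewrite dpush_img; [rewrite /= inj_eq//|]; exact: Psi_inj.
  rewrite dpush_nimg => [|V' eV]; last by apply: nW; exists V'.
  by rewrite /=; case: eqP => // eV; case: nW; exists V.
case: (pselect (exists Ls, red_v M Ls)) => [[Ls rM]|sM]; last first.
  have {}sM Ls : ~ red_v M Ls by move=> rM; apply: sM; exists Ls.
  by rewrite (stuck_cps R inl E sM) approx_stuck// /= /push_mass esum1.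
rewrite (red_v_six_steps R _ (red_v_rename inl rM)) !size_map !big_map.
(* Rewritten backwards, the induction hypothesis reduces the goal to push-forward commuting with
   averages, checked on and off the image of [Psi]. *)
have {}IH L : dpush Psi (approx R (@red_v _) n L) W = _ := IH L W.
under eq_bigr do rewrite -IH.
case: (pselect (exists V, Psi V = W)) => [[V <-]|nW].
  rewrite dpush_img; last exact: Psi_inj.
  rewrite (approx_red _ (@red_v_value _) (@red_v_det _) _ _ rM).
  by congr (_ * _); apply: eq_bigr => L _; rewrite dpush_img //; exact: Psi_inj.
have {}nW V : Psi V <> W by move=> eV; apply: nW; exists V.
rewrite dpush_nimg// big1 ?mulr0// => L _; exact: dpush_nimg.
Qed.

Theorem theorem5 (R : realType) (M : Lambda) :
  closed_term M ->
  dpush Psi (S_IV R M) = S_IN R (App (trans M) (Lam (Var None))).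
Proof.
move=> _; apply: distr_eq => W.
(* Sampling the target at multiples of six makes its approximants the push-forwards of the source
   ones, index by index. *)
rewrite /S_IN (dsup_approx (@red_n_value _) (@red_n_det _) (k := 6))//.
under eq_fun do rewrite -dpush_approx.
case: (pselect (exists V, Psi V = W)) => [[V <-]|nW].
  rewrite dpush_img; last exact: Psi_inj.
  rewrite /S_IV (dsup_approx (@red_v_value _) (@red_v_det _) (k := 1))//.
  congr (sup (image setT _)); apply/funext => n.
  by rewrite mul1n dpush_img//; exact: Psi_inj.
have {}nW V : Psi V <> W by move=> eV; apply: nW; exists V.
under eq_fun do rewrite dpush_nimg//.
rewrite dpush_nimg// (_ : range _ = [set 0]) ?sup1//.
by apply/seteqP; split=> [_ [n _ <-]|_ ->] //=; exists 0%N.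
Qed.
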